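(* Let $K$ be a complete discretely valued field with uniformizer $\pi$ and residue field of characteristic different from $2$, and let $D=\left(\frac{a,\pi}{K}\right)$ be a quaternion division algebra over $K$ with $a\in\mathcal{O}_K^*$, with $K$-basis $1,x,y,z$ where $x^2=a$, $y^2=\pi$, $z=xy=-yx$ (the ramified case). Let $\sigma\in\{\tau,\tau_x,\tau_y\}$ and $\epsilon\in\{1,-1\}$. Let $\delta,\alpha,\beta,\gamma\in\mathcal{O}_K$ be such that $h=\langle\delta+\alpha x+\beta y+\gamma z\rangle$ is a one-dimensional unramified $\epsilon$-hermitian form over $(D,\sigma)$. Then $h\cong\langle\delta+\alpha x\rangle$ as $\epsilon$-hermitian forms over $(D,\sigma)$.
   Context: $\mathcal{O}_K$ is the valuation ring of the normalized valuation $\nu_K$ of $K$. $\nu_D(d)=\frac12\nu_K(\mathrm{Nrd}(d))$ for $d\in D\setminus\{0\}$ is the extension of $\nu_K$ to $D$; an element of $D$ is a unit if its $\nu_D$-value is $0$. $\tau$ is the canonical (symplectic) involution of $D$: $\tau(x)=-x$, $\tau(y)=-y$, $\tau(z)=-z$. For $\lambda\in\{x,y\}$, $\tau_\lambda(d)=\lambda\tau(d)\lambda^{-1}$. For $u\in D^*$ with $\sigma(u)=\epsilon u$, $\langle u\rangle$ is the one-dimensional $\epsilon$-hermitian form $(d,d')\mapsto\sigma(d)ud'$ on $D$; thus $\langle u\rangle\cong\langle v\rangle$ iff $v=\sigma(t)ut$ for some $t\in D^*$. An $\epsilon$-hermitian form over $(D,\sigma)$ is called unramified if it is isometric to a diagonal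 form all of whose diagonal entries are units of $D$. *)

(* Defs.v *)
From HB Require Import structures.
From mathcomp Require Import all_boot all_order all_algebra.
From mathcomp Require Import generic_quotient ring_quotient ring.

Set Implicit Arguments.
Unset Strict Implicit.
Unset Printing Implicit Defensive.

Import Order.TTheory GRing.Theory Num.Theory.
Local Open Scope ring_scope.

(* The value nu 0 is unconstrained, so every use of [nu x] below is guarded
   by [x != 0] (mathematically nu 0 = +oo). *)
Record normalizedValuation (K : fieldType) := NormalizedValuation {
  valuation_fun :> K -> int;
  valuationM : forall x y, x != 0 -> y != 0 ->
    valuation_fun (x * y) = valuation_fun x + valuation_fun y;
  valuationD : forall x y, x != 0 -> y != 0 -> x + y != 0 ->
    Num.min (valuation_fun x) (valuation_fun y) <= valuation_fun (x + y);
  valuation_onto : forall n : int, exists2 x, x != 0 & valuation_fun x = n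
}.

Section Valuation.
Variables (K : fieldType) (nu : normalizedValuation K).

Definition vball (N : int) : {pred K} := [pred x | (x == 0) || (N <= nu x)].

Definition vcomplete : Prop :=
  forall u : nat -> K,
    (forall N : int, exists m : nat, forall i j : nat,
       (m <= i)%N -> (m <= j)%N -> u i - u j \in vball N) ->
    exists l : K, forall N : int, exists m : nat, forall i : nat,
      (m <= i)%N -> u i - l \in vball N.

Definition uniformizer (p : K) : Prop := p != 0 /\ nu p = 1.

Definition valring : {pred K} := vball 0.

Definition valring_unit (x : K) : Prop :=
  [/\ x != 0, x \in valring & x^-1 \in valring].

Lemma valuation1 : nu 1 = 0.
Proof.
have := valuationM nu (oner_neq0 K) (oner_neq0 K); rewrite mulr1 => h.
by apply: (addrI (nu 1)); rewrite addr0 -h.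
Qed.

Lemma valuationN1 : nu (-1) = 0.
Proof.
have n0 : (-1 : K) != 0 by rewrite oppr_eq0 oner_eq0.
have := valuationM nu n0 n0; rewrite mulrNN mulr1 valuation1.
by move/eqP; rewrite -mulr2n eq_sym mulrn_eq0 /= => /eqP.
Qed.

Lemma valuationN x : x != 0 -> nu (- x) = nu x.
Proof.
move=> x0; have n0 : (-1 : K) != 0 by rewrite oppr_eq0 oner_eq0.
by rewrite -mulN1r valuationM // valuationN1 add0r.
Qed.

Lemma vball_zmod_closed N : zmod_closed (vball N).
Proof.
split=> [|x y]; first by rewrite inE eqxx.
rewrite !inE; have [->|x0] := eqVneq x 0.
  rewrite sub0r oppr_eq0; have [->//|y0] := eqVneq y 0.
  by rewrite /= valuationN.
have [->|y0] := eqVneq y 0; first by rewrite subr0 /= => ->; rewrite orbT.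
have [//|xy0 /= hx hy] := eqVneq (x - y) 0.
have y0' : - y != 0 by rewrite oppr_eq0.
apply: le_trans (valuationD nu x0 y0' xy0).
by rewrite valuationN // le_min hx.
Qed.

Lemma vballM M N x y : x \in vball M -> y \in vball N -> x * y \in vball (M + N).
Proof.
rewrite !inE mulf_eq0.
have [->//|x0] := eqVneq x 0; have [->//|y0 /= hx hy] := eqVneq y 0.
by rewrite valuationM // lerD.
Qed.

Lemma valring_subring_closed : subring_closed valring.
Proof.
split=> [|x y|x y]; first by rewrite inE valuation1 lexx orbT.
  exact: (vball_zmod_closed 0).2.
exact: vballM.
Qed.

HB.instance Definition _ :=
  GRing.isSubringClosed.Build K valring valring_subring_closed.

Record integers := Integers { int_val :> K; int_valP : int_val \in valring }.
HB.instance Definition _ := [isSub for int_val].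
HB.instance Definition _ := [Choice of integers by <:].
HB.instance Definition _ := [SubChoice_isSubComNzRing of integers by <:].

Definition maxideal : {pred integers} := [pred x | int_val x \in vball 1].

Lemma maxideal_closed : idealr_closed maxideal.
Proof.
split=> [||c x y]; rewrite ?inE /=; first by rewrite eqxx.
  by rewrite oner_eq0 valuation1.
move=> hx hy; have [_ hB] := vball_zmod_closed 1.
have hcx : int_val c * int_val x \in vball (0 + 1).
  exact: vballM (int_valP c) hx.
rewrite add0r in hcx; have h0 : - int_val y \in vball 1.
  by rewrite -sub0r; apply: hB => //; rewrite inE eqxx.
by have := hB _ _ hcx h0; rewrite opprK.
Qed.

HB.instance Definition _ := isIdealr.Build integers maxideal maxideal_closed.

Definition residue_field := {ideal_quot maxideal}.
HB.instance Definition _ := GRing.ComNzRing.on residue_field.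

End Valuation.

(* The quaternion algebra (a, b / K) on the basis 1, x, y, z = xy, with x^2 = a
   and y^2 = b; [Quaternion p q r s] is p + q x + r y + s z. *)
Record quaternion (K : fieldType) (a b : K) := Quaternion {
  qre : K; qix : K; qjy : K; qkz : K
}.

Section QuaternionAlgebra.
Variables (K : fieldType) (a b : K).
Local Notation D := (quaternion a b).
Local Notation Q := (@Quaternion K a b).

Definition quat_tuple (d : D) : K * K * K * K := (qre d, qix d, qjy d, qkz d).
Definition tuple_quat (t : K * K * K * K) : D :=
  let: (p, q, r, s) := t in Q p q r s.
Lemma quat_tupleK : cancel quat_tuple tuple_quat.
Proof. by case. Qed.

HB.instance Definition _ := Choice.copy D (can_type quat_tupleK).

Lemma quatP (d e : D) : qre d = qre e -> qix d = qix e ->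
  qjy d = qjy e -> qkz d = qkz e -> d = e.
Proof. by case: d => ????; case: e => ???? /= -> -> -> ->. Qed.

Definition qzero : D := Q 0 0 0 0.
Definition qopp (d : D) : D := Q (- qre d) (- qix d) (- qjy d) (- qkz d).
Definition qadd (d e : D) : D :=
  Q (qre d + qre e) (qix d + qix e) (qjy d + qjy e) (qkz d + qkz e).
Definition qone : D := Q 1 0 0 0.
Definition qscale (c : K) (d : D) : D :=
  Q (c * qre d) (c * qix d) (c * qjy d) (c * qkz d).
(* The bilinear extension of x^2 = a, y^2 = b, xy = -yx = z; hence z^2 = -ab,
   xz = ay = -zx and zy = bx = -yz. *)
Definition qmul (d e : D) : D :=
  Q (qre d * qre e + a * (qix d * qix e) + b * (qjy d * qjy e)
       - a * b * (qkz d * qkz e))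
    (qre d * qix e + qix d * qre e + b * (qkz d * qjy e - qjy d * qkz e))
    (qre d * qjy e + qjy d * qre e + a * (qix d * qkz e - qkz d * qix e))
    (qre d * qkz e + qkz d * qre e + qix d * qjy e - qjy d * qix e).

Lemma qaddA : associative qadd.
Proof. by move=> d e f; apply: quatP; rewrite /= addrA. Qed.
Lemma qaddC : commutative qadd.
Proof. by move=> d e; apply: quatP; rewrite /= addrC. Qed.
Lemma qadd0 : left_id qzero qadd.
Proof. by move=> d; apply: quatP; rewrite /= add0r. Qed.
Lemma qaddN : left_inverse qzero qopp qadd.
Proof. by move=> d; apply: quatP; rewrite /= addNr. Qed.
HB.instance Definition _ := GRing.isZmodule.Build D qaddA qaddC qadd0 qaddN.

Lemma qmulA : associative qmul.
Proof. by move=> d e f; apply: quatP => /=; ring. Qed.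
Lemma qmul1l : left_id qone qmul.
Proof. by move=> d; apply: quatP => /=; ring. Qed.
Lemma qmul1r : right_id qone qmul.
Proof. by move=> d; apply: quatP => /=; ring. Qed.
Lemma qmulDl : left_distributive qmul +%R.
Proof. by move=> d e f; apply: quatP => /=; ring. Qed.
Lemma qmulDr : right_distributive qmul +%R.
Proof. by move=> d e f; apply: quatP => /=; ring. Qed.
Lemma qone_neq0 : qone != 0.
Proof. by apply/eqP => -[] /eqP; rewrite oner_eq0. Qed.
HB.instance Definition _ :=
  GRing.Zmodule_isNzRing.Build D qmulA qmul1l qmul1r qmulDl qmulDr qone_neq0.

Lemma qscaleA c c' d : qscale c (qscale c' d) = qscale (c * c') d.
Proof. by apply: quatP; rewrite /= mulrA. Qed.
Lemma qscale1 : left_id 1 qscale.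
Proof. by move=> d; apply: quatP; rewrite /= mul1r. Qed.
Lemma qscaleDr : right_distributive qscale +%R.
Proof. by move=> c d e; apply: quatP; rewrite /= mulrDr. Qed.
Lemma qscaleDl d : {morph qscale^~ d : c c' / c + c'}.
Proof. by move=> c c'; apply: quatP; rewrite /= mulrDl. Qed.
HB.instance Definition _ :=
  GRing.Zmodule_isLmodule.Build K D qscaleA qscale1 qscaleDr qscaleDl.

Lemma qscaleAl (c : K) (d e : D) : c *: (d * e) = (c *: d) * e.
Proof. by apply: quatP => /=; ring. Qed.
HB.instance Definition _ := GRing.Lmodule_isLalgebra.Build K D qscaleAl.
Lemma qscaleAr (c : K) (d e : D) : c *: (d * e) = d * (c *: e).
Proof. by apply: quatP => /=; ring. Qed.
HB.instance Definition _ := GRing.Lalgebra_isAlgebra.Build K D qscaleAr.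

Definition qx : D := Q 0 1 0 0.
Definition qy : D := Q 0 0 1 0.
Definition qz : D := Q 0 0 0 1.

Lemma qx2 : qx ^+ 2 = a%:A.
Proof. by apply: quatP => /=; ring. Qed.
Lemma qy2 : qy ^+ 2 = b%:A.
Proof. by apply: quatP => /=; ring. Qed.
Lemma qxy : qx * qy = qz.
Proof. by apply: quatP => /=; ring. Qed.
Lemma qyx : qy * qx = - qz.
Proof. by apply: quatP => /=; ring. Qed.
Lemma quatE (d : D) :
  d = (qre d)%:A + qix d *: qx + qjy d *: qy + qkz d *: qz.
Proof. by apply: quatP => /=; ring. Qed.

Definition tau (d : D) : D := Q (qre d) (- qix d) (- qjy d) (- qkz d).

Definition nrd (d : D) : K :=
  qre d ^+ 2 - a * qix d ^+ 2 - b * qjy d ^+ 2 + a * b * qkz d ^+ 2.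

Lemma mulq_tau (d : D) : d * tau d = (nrd d)%:A.
Proof. by apply: quatP; rewrite /= /nrd; ring. Qed.
Lemma mul_tauq (d : D) : tau d * d = (nrd d)%:A.
Proof. by apply: quatP; rewrite /= /nrd; ring. Qed.
Lemma nrdM (d e : D) : nrd (d * e) = nrd d * nrd e.
Proof. by rewrite /nrd /=; ring. Qed.
Lemma nrd1 : nrd 1 = 1.
Proof. by rewrite /nrd /=; ring. Qed.

Definition qunit : pred D := fun d => nrd d != 0.
Definition qinv (d : D) : D :=
  if nrd d != 0 then (nrd d)^-1 *: tau d else d.

Lemma qmulVr : {in qunit, left_inverse 1 qinv *%R}.
Proof.
move=> d hd; rewrite /qinv (hd : nrd d != 0) -scalerAl mul_tauq scalerA.
by rewrite mulVf ?scale1r.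
Qed.
Lemma qdivrr : {in qunit, right_inverse 1 qinv *%R}.
Proof.
move=> d hd; rewrite /qinv (hd : nrd d != 0) -scalerAr mulq_tau scalerA.
by rewrite mulVf ?scale1r.
Qed.
Lemma qunitP (d e : D) : e * d = 1 /\ d * e = 1 -> qunit d.
Proof.
move=> [] /(congr1 nrd); rewrite nrdM nrd1 => h _.
by apply/eqP => d0; move/eqP: h; rewrite d0 mulr0 eq_sym oner_eq0.
Qed.
Lemma qinv_out : {in [predC qunit], qinv =1 id}.
Proof. by move=> d hd; rewrite /qinv ifN. Qed.
HB.instance Definition _ :=
  GRing.NzRing_hasMulInverse.Build D qmulVr qdivrr qunitP qinv_out.

Definition tau_ (l d : D) : D := l * tau d * l^-1.

Definition division_algebra : Prop := forall d : D, d != 0 -> d \is a GRing.unit.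

Definition nuD (nu : normalizedValuation K) (d : D) : rat :=
  (nu (nrd d))%:~R / 2.

Definition nuD_unit (nu : normalizedValuation K) (d : D) : Prop :=
  d != 0 /\ nuD nu d = 0.

End QuaternionAlgebra.

Arguments qx {K a b}.
Arguments qy {K a b}.
Arguments qz {K a b}.
Arguments tau {K a b}.

(* Forms live on the right D-modules D^n of column vectors, D acting on the
   right entrywise. *)
Section HermitianForms.
Variables (D : nzRingType) (sigma : D -> D) (eps : D).

Definition form n := 'cV[D]_n -> 'cV[D]_n -> D.

Definition rscale n (v : 'cV[D]_n) (d : D) : 'cV[D]_n := \col_i (v i 0 * d).

Record eps_hermitian n (h : form n) : Prop := EpsHermitian {
  herm_addl : forall v v' w, h (v + v') w = h v w + h v' w;
  herm_addr : forall v w w', h v (w + w') = h v w + h v w';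
  herm_scale : forall v w c d,
    h (rscale v c) (rscale w d) = sigma c * h v w * d;
  herm_sym : forall v w, h w v = eps * sigma (h v w);
  herm_nondeg : forall v, (forall w, h v w = 0) -> v = 0
}.

Definition isometric m n (h : form m) (h' : form n) : Prop :=
  exists f : 'cV[D]_m -> 'cV[D]_n,
    [/\ bijective f,
        forall v w, f (v + w) = f v + f w,
        forall v d, f (rscale v d) = rscale (f v) d &
        forall v w, h' (f v) (f w) = h v w].

Definition diag_form n (u : 'I_n -> D) : form n :=
  fun v w => \sum_(i < n) sigma (v i 0) * u i * w i 0.

Definition rank1_form (u : D) : form 1 := diag_form (fun _ : 'I_1 => u).

End HermitianForms.

Definition unramified (K : fieldType) (nu : normalizedValuation K) (a b : K)
    (sigma : quaternion a b -> quaternion a b) (eps : quaternion a b)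
    n (h : form (quaternion a b) n) : Prop :=
  eps_hermitian sigma eps h /\
  exists m (u : 'I_m -> quaternion a b),
    [/\ eps_hermitian sigma eps (diag_form sigma u),
        forall i, nuD_unit nu (u i) &
        isometric h (diag_form sigma u)].

(* Over a division ring, <u> is an eps-hermitian form exactly when u is nonzero
   and sigma u = eps u, and <u>, <v> are isometric exactly when
   v = sigma(t) u t for some invertible t. *)
Section Rank1.
Variables (D : unitRingType) (sigma : D -> D) (eps : D).
Hypothesis divD : forall d : D, d != 0 -> d \is a GRing.unit.
Hypothesis sigmaD : {morph sigma : c d / c + d}.
Hypothesis sigmaM : forall c d, sigma (c * d) = sigma d * sigma c.
Hypothesis sigmaK : involutive sigma.
Hypothesis epsE : eps = 1 \/ eps = -1.

Let sigma1 : sigma 1 = 1.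
Proof. by rewrite -[LHS]mulr1 -{2}[1]sigmaK -sigmaM mulr1 sigmaK. Qed.

Let rank1E u v w : rank1_form sigma u v w = sigma (v 0 0) * u * w 0 0.
Proof. by rewrite /rank1_form /diag_form big_ord1. Qed.

Let eps_comm c : eps * c = c * eps.
Proof. by case: epsE => ->; rewrite ?mul1r ?mulr1 ?mulN1r ?mulrN1. Qed.

Let eps2 : eps * eps = 1.
Proof. by case: epsE => ->; rewrite ?mulr1 ?mulrNN ?mulr1. Qed.

Let cV1P (v w : 'cV[D]_1) : v 0 0 = w 0 0 -> v = w.
Proof. by move=> h; apply/matrixP => i j; rewrite !ord1. Qed.

Lemma rank1_hermitianP u :
  eps_hermitian sigma eps (rank1_form sigma u) <->
  u != 0 /\ sigma u = eps * u.
Proof.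
have sigma0 : sigma 0 = 0 by apply: (addrI (sigma 0)); rewrite -sigmaD !addr0.
split=> [h|[u0 su]].
  split.
    apply/eqP => u0.
    have /matrixP/(_ 0 0)/eqP : const_mx 1 = 0 :> 'cV[D]_1.
      by apply: (herm_nondeg h) => w; rewrite rank1E u0 mulr0 mul0r.
    by rewrite !mxE oner_eq0.
  have := herm_sym h (const_mx 1) (const_mx 1).
  rewrite !rank1E !mxE sigma1 mul1r mulr1 => {2}->.
  by rewrite mulrA eps2 mul1r.
split.
- by move=> v v' w; rewrite !rank1E mxE sigmaD !mulrDl.
- by move=> v w w'; rewrite !rank1E mxE mulrDr.
- by move=> v w c d; rewrite !rank1E !mxE sigmaM !mulrA.
- move=> v w; rewrite !rank1E !sigmaM sigmaK su !mulrA eps_comm.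
  by rewrite -(mulrA (sigma _) eps eps) eps2 mulr1.
move=> v /(_ (const_mx 1)); rewrite rank1E mxE mulr1 => h.
have hv : sigma (v 0 0) = 0 by rewrite -[LHS](mulrK (divD u0)) h mul0r.
by apply: cV1P; rewrite mxE -[LHS]sigmaK hv.
Qed.

Lemma rank1_isometricP u v :
  isometric (rank1_form sigma u) (rank1_form sigma v) <->
  exists2 t, t != 0 & v = sigma t * u * t.
Proof.
split=> [[f [[g fK gK] fD fZ fh]]|[t t0 ->]].
  pose t := f (const_mx 1) 0 0.
  have t0 : t != 0.
    apply/eqP => t0; have f0 : f 0 = 0.
      by apply: (addrI (f 0)); rewrite -fD !addr0.
    have : const_mx 1 = 0 :> 'cV[D]_1.
      by apply: (can_inj fK); rewrite f0; apply: cV1P; rewrite mxE.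
    by move/matrixP/(_ 0 0)/eqP; rewrite !mxE oner_eq0.
  have := fh (const_mx 1) (const_mx 1).
  rewrite !rank1E !mxE sigma1 mul1r mulr1 -/t => <-.
  exists t^-1; first by rewrite invr_eq0.
  by rewrite !mulrA -sigmaM divrr ?divD // sigma1 mul1r mulrK ?divD.
have ut := divD t0.
exists (fun w : 'cV[D]_1 => const_mx (t^-1 * w 0 0) : 'cV[D]_1); split.
- exists (fun w : 'cV[D]_1 => const_mx (t * w 0 0) : 'cV[D]_1) => w; apply: cV1P; rewrite !mxE.
    by rewrite mulVKr.
  by rewrite mulKr.
- by move=> w w'; apply: cV1P; rewrite !mxE mulrDr.
- by move=> w d; apply: cV1P; rewrite !mxE mulrA.
move=> w w'; rewrite !rank1E !mxE sigmaM !mulrA mulrK //.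
by rewrite -[_ * sigma t]mulrA -sigmaM divrr // sigma1 mulr1.
Qed.
End Rank1.

(* Main.v *)
Require Import Defs.
From mathcomp Require Import all_boot all_order all_algebra.
From mathcomp Require Import generic_quotient ring_quotient ring zify.

Set Implicit Arguments.
Unset Strict Implicit.
Unset Printing Implicit Defensive.

Import Order.TTheory GRing.Theory Num.Theory.
Local Open Scope ring_scope.

(** Write u for the given entry and u0 = delta + alpha x for its part in K(x).
    The claim amounts to finding t with sigma(t) u t = u0.

    The three involutions are all of the form tau_l, d |-> l tau(d) l^-1, with
    l = 1, x or y.  Multiplying by l^-1 turns the equation into
    tau(t) v t = v0 for v = l^-1 u and v0 = l^-1 u0, and sigma u = eps u says
    that v is fixed or negated by tau ([tau_twist]).  If v is fixed, it is a
    scalar c and u = c l lies in K(x) or is orthogonal to it; the second option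
    will be excluded by u0 <> 0, and in the first u = u0.

    If v is negated, so is v0, because tau_l preserves K(x); thus v and v0 are
    pure quaternions.  Pure quaternions of equal norm are conjugate, and a
    conjugation t^-1 v t is tau(t) v t up to the scalar nrd t; what is left is
    to adjust scalars.  This succeeds as soon as nrd u / nrd u0 is a square s^2
    and (1 + s) / 2 is a nonzero square ([pure_rank1]).

    By completeness and residue characteristic different from 2, every 1-unit
    is the square of a 1-unit ([sqrt_one_unit]); so it is enough that
    nrd u / nrd u0 be a 1-unit.  Now nrd u = nrd u0 + nrd (u - u0), where
    nrd u0 is a norm from K(x) and nrd (u - u0) is -pi times such a norm.  Since
    D is division, a is not a square, and norms from K(x) have even value
    ([norm_valuation_even]).  Thus the two terms have values of opposite
    parity.  An unramified form represents a unit of D, so nrd u has even value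
    ([isometric_represents]); hence nrd u0 strictly dominates
    ([xpart_dominant]). *)

(** * Valuations, 1-units and their square roots *)

Section Balls.
Variables (K : fieldType) (nu : normalizedValuation K).
Implicit Types (x y : K) (M N : int).

Lemma vball0 N : 0 \in vball nu N.
Proof. by rewrite inE eqxx. Qed.

Lemma vballB N x y : x \in vball nu N -> y \in vball nu N ->
  x - y \in vball nu N.
Proof. exact: (vball_zmod_closed nu N).2. Qed.

Lemma vballN N x : x \in vball nu N -> - x \in vball nu N.
Proof. by move=> h; rewrite -sub0r vballB // vball0. Qed.

Lemma vballD N x y : x \in vball nu N -> y \in vball nu N ->
  x + y \in vball nu N.
Proof. by move=> hx hy; rewrite -[y]opprK vballB // vballN. Qed.

Lemma vball_le M N x : M <= N -> x \in vball nu N -> x \in vball nu M.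
Proof.
by move=> MN; rewrite !inE => /orP[->//|h]; rewrite (le_trans MN h) orbT.
Qed.

Lemma vball_eq0 x : (forall N, x \in vball nu N) -> x = 0.
Proof.
move=> /(_ (nu x + 1)); rewrite inE => /orP[/eqP//|].
by rewrite gerDl.
Qed.

Lemma oner_notin_vball1 : 1 \notin vball nu 1.
Proof. by rewrite inE oner_eq0 valuation1. Qed.

Lemma one_unit_neq0 x : x - 1 \in vball nu 1 -> x != 0.
Proof.
apply: contraL => /eqP ->; rewrite sub0r.
apply: contra oner_notin_vball1 => /vballN.
by rewrite opprK.
Qed.

Lemma valuationV x : x != 0 -> nu x^-1 = - nu x.
Proof.
move=> x0; apply/eqP; rewrite -addr_eq0 -valuationM ?invr_eq0 //.
by rewrite mulVf // valuation1.
Qed.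

Lemma valuationX2 x : x != 0 -> nu (x ^+ 2) = nu x *+ 2.
Proof. by move=> x0; rewrite expr2 valuationM. Qed.

Lemma div_vball1 x y : y != 0 -> (x != 0 -> nu y < nu x) ->
  x / y \in vball nu 1.
Proof.
move=> y0; have [->|x0 /(_ isT) h] := eqVneq x 0; first by rewrite mul0r vball0.
rewrite inE valuationM ?invr_eq0 // valuationV //.
by apply/orP; right; lia.
Qed.

(** If the sum had value larger than [nu x], so would both terms of
    [(x + y) - y = x]. *)
Lemma valuationD_lt x y : x != 0 -> y != 0 -> nu x < nu y -> nu (x + y) = nu x.
Proof.
move=> x0 y0 xy.
have xy0 : x + y != 0.
  apply: contraTneq xy => /eqP; rewrite addr_eq0 => /eqP ->.
  by rewrite valuationN // ltxx.
have := valuationD nu x0 y0 xy0; have ny0 : - y != 0 by rewrite oppr_eq0.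
have := @valuationD _ nu _ _ xy0 ny0; rewrite addrK valuationN // => /(_ x0).
by rewrite !ge_min; move: xy; move: (nu x) (nu y) (nu (x + y)) => i j k; lia.
Qed.

Lemma valuation_unit x : valring_unit nu x -> nu x = 0.
Proof.
case=> x0; rewrite !inE invr_eq0 (negPf x0) /= valuationV //; lia.
Qed.

Lemma residue_char_neq2 : 2%N \notin [pchar (residue_field nu)] ->
  2 != 0 :> K /\ nu 2 = 0.
Proof.
move=> hchar; have v2 : (2 : K) \in valring nu by rewrite rpred_nat.
suff: (2 : K) \notin vball nu 1.
  move: v2; rewrite !inE; have [//|_ /=] := eqVneq (2 : K) 0; lia.
apply: contra hchar => h2; rewrite inE /=.
have two_ideal : (2 : integers nu) - 0 \in @maxideal _ nu.
  by rewrite subr0.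
move: two_ideal; rewrite Quotient.idealrBE => /eqP h.
apply/eqP; transitivity (\pi_(residue_field nu)%qT (2 : integers nu)).
  by rewrite rmorph_nat.
by rewrite h rmorph0.
Qed.

Hypotheses (hK : vcomplete nu) (two0 : 2 != 0 :> K) (nu2 : nu 2 = 0).

Lemma half_vball N x : x \in vball nu N -> x / 2 \in vball nu N.
Proof.
move=> h; rewrite -[N]addr0; apply: vballM h _.
by rewrite inE valuationV // nu2 oppr0 lexx orbT.
Qed.

(** The fixed points [e] of [F e = (m - e^2) / 2] are the solutions of
    [(1 + e)^2 = 1 + m].  On the maximal ideal [F] is a contraction, because
    [F e - F f = - (e - f) (e + f) / 2]. *)
Lemma sqrt_one_unit m : m \in vball nu 1 ->
  exists2 s, s ^+ 2 = 1 + m & s - 1 \in vball nu 1.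
Proof.
move=> hm; pose F e := (m - e ^+ 2) / 2; pose u n := iter n F 0.
have FB (N : int) e f : e \in vball nu 1 -> f \in vball nu 1 ->
    e - f \in vball nu N -> F e - F f \in vball nu (N + 1).
  move=> he hf hef; have -> : F e - F f = - ((e - f) * (e + f) / 2).
    by rewrite /F; field.
  by apply/vballN/half_vball/vballM => //; exact: vballD.
have u1 n : u n \in vball nu 1.
  elim: n => [|n IH] /=; first exact: vball0.
  apply/half_vball/vballB => //; apply: (@vball_le _ (1 + 1)) => //.
  exact: vballM.
have uS n : u n.+1 - u n \in vball nu n%:Z.
  elim: n => [|n IH]; first by rewrite subr0; apply: vball_le (u1 1%N).
  have -> : Posz n.+1 = n%:Z + 1 by rewrite -addn1 PoszD.
  exact: (FB _ (u n.+1) (u n)).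
have uD n k : u (n + k)%N - u n \in vball nu n%:Z.
  elim: k => [|k IH]; first by rewrite addn0 subrr vball0.
  rewrite addnS -(subrK (u (n + k)%N) (u _)) -addrA; apply: vballD => //.
  by apply: vball_le (uS _); lia.
have [l hl] : exists l, forall N : int, exists n : nat, forall i : nat,
    (n <= i)%N -> u i - l \in vball nu N.
  apply: hK => N; exists `|N|%N => i j hi hj.
  have aux k : (`|N| <= k)%N -> u k - u `|N|%N \in vball nu N.
    move=> hk; rewrite -(subnKC hk); apply: vball_le (uD _ _); lia.
  have -> : u i - u j = (u i - u `|N|%N) - (u j - u `|N|%N) by ring.
  by apply: vballB; apply: aux.
have l1 : l \in vball nu 1.
  have [n /(_ n (leqnn n)) h] := hl 1.
  have -> : l = u n - (u n - l) by ring.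
  exact: vballB.
have lF : F l = l.
  apply/eqP; rewrite -subr_eq0; apply/eqP/vball_eq0 => N.
  have [n h] := hl N.
  have -> : F l - l = (u n.+1 - l) - (F (u n) - F l) by rewrite /u /=; ring.
  apply: vballB; first exact/h/leqnSn.
  by apply: (@vball_le _ (N + 1)); [lia | apply: FB => //; apply: h].
exists (1 + l); last by rewrite addrAC subrr add0r.
have -> : m = 2 * F l + l ^+ 2 by rewrite /F; field.
by rewrite lF; ring.
Qed.

(** The values of [p^2] and [a q^2] are even, so the only problem is a
    cancellation between them; but then [a q^2 / p^2] is a 1-unit, hence a
    square, and so is [a]. *)
Lemma norm_valuation_even a p q : nu a = 0 -> (forall c, c ^+ 2 != a) ->
  p ^+ 2 - a * q ^+ 2 != 0 -> exists k : int, nu (p ^+ 2 - a * q ^+ 2) = k *+ 2.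
Proof.
move=> nua ha; have a0 : a != 0 by rewrite eq_sym -[0](expr0n K 2) ha.
have [->|p0] := eqVneq p 0.
  rewrite expr0n /= sub0r oppr_eq0 mulf_eq0 negb_or => /andP[_].
  rewrite expf_eq0 /= => q0; exists (nu q).
  rewrite valuationN ?mulf_neq0 ?expf_neq0 // valuationM ?expf_neq0 //.
  by rewrite nua add0r valuationX2.
have [->|q0] := eqVneq q 0.
  by exists (nu p); rewrite expr0n /= mulr0 subr0 valuationX2.
move=> N0; have P0 : p ^+ 2 != 0 by rewrite expf_neq0.
have aq0 : a * q ^+ 2 != 0 by rewrite mulf_neq0 ?expf_neq0.
have Q0 : - (a * q ^+ 2) != 0 by rewrite oppr_eq0.
have nP : nu (p ^+ 2) = nu p *+ 2 by rewrite valuationX2.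
have nQ : nu (- (a * q ^+ 2)) = nu q *+ 2.
  by rewrite valuationN // valuationM ?expf_neq0 // nua add0r valuationX2.
have [lt_PQ|lt_QP|eq_PQ] := ltgtP (nu (p ^+ 2)) (nu (- (a * q ^+ 2))).
- by exists (nu p); rewrite valuationD_lt.
- by exists (nu q); rewrite addrC valuationD_lt.
exists (nu p); have := valuationD nu P0 Q0 N0; rewrite -eq_PQ minxx -nP.
rewrite le_eqVlt => /orP[/eqP //|lt_PN].
have /vballN/sqrt_one_unit[s s2 s1] :
    (p ^+ 2 - a * q ^+ 2) / p ^+ 2 \in vball nu 1.
  exact: div_vball1.
have /eqP[] := ha (s * p / q).
rewrite !exprMn s2 exprVn; field.
by rewrite p0 q0.
Qed.

End Balls.

(** * Rank one forms over the quaternion algebra *)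

Section Involutions.
Variables (K : fieldType) (a b : K).
Local Notation D := (quaternion a b).
Implicit Types (d e l v : D).

Lemma tauM d e : tau (d * e) = tau e * tau d.
Proof. by apply: quatP => /=; ring. Qed.

Lemma tauD d e : tau (d + e) = tau d + tau e.
Proof. by apply: quatP => /=; ring. Qed.

Lemma tauZ (c : K) d : tau (c *: d) = c *: tau d.
Proof. by apply: quatP => /=; ring. Qed.

Lemma tauK : involutive (@tau K a b).
Proof. by move=> d; apply: quatP => /=; ring. Qed.

Lemma tau1 : tau (1 : D) = 1.
Proof. by apply: quatP => /=; ring. Qed.

Lemma nrd_tau d : nrd (tau d) = nrd d.
Proof. by rewrite /nrd /=; ring. Qed.

Lemma unit_nrd d : (d \is a GRing.unit) = (nrd d != 0).
Proof. by []. Qed.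

Lemma tauV d : d \is a GRing.unit -> tau d^-1 = (tau d)^-1.
Proof.
move=> ud; apply: (@mulrI _ (tau d)); first by rewrite unit_nrd nrd_tau.
by rewrite -tauM mulVr // tau1 divrr // unit_nrd nrd_tau.
Qed.

Lemma tau_1 : tau_ (1 : D) =1 tau.
Proof. by move=> d; rewrite /tau_ mul1r invr1 mulr1. Qed.

Lemma tau_D l : {morph tau_ l : d e / d + e}.
Proof. by move=> d e; rewrite /tau_ tauD mulrDr mulrDl. Qed.

Lemma tau_M l d e : l \is a GRing.unit ->
  tau_ l (d * e) = tau_ l e * tau_ l d.
Proof. by move=> ul; rewrite /tau_ tauM !mulrA mulrVK. Qed.

Lemma nrd_tau_ l d : l \is a GRing.unit -> nrd (tau_ l d) = nrd d.
Proof.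
move=> ul; rewrite /tau_ !nrdM nrd_tau mulrAC -nrdM divrr // nrd1 mul1r //.
Qed.

Lemma tau_K l (eta : D) : l \is a GRing.unit -> tau l = eta * l ->
  eta = 1 \/ eta = -1 -> involutive (tau_ l).
Proof.
move=> ul tl he d; rewrite /tau_ !tauM tauV // tauK tl.
case: he => ->; rewrite ?mul1r ?mulN1r ?invrN.
  by rewrite !mulrA divrr // mul1r mulrK.
by rewrite !(mulrN, mulNr) opprK !mulrA divrr // mul1r mulrK.
Qed.

Lemma tau_E l d e : l \is a GRing.unit -> l * tau d = e * l -> tau_ l d = e.
Proof. by move=> ul h; rewrite /tau_ h mulrK. Qed.

Lemma tau_qxE d : qx \is a @GRing.unit D ->
  tau_ qx d = Quaternion a b (qre d) (- qix d) (qjy d) (qkz d).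
Proof. by move=> ux; apply: tau_E => //; apply: quatP => /=; ring. Qed.

Lemma tau_qyE d : qy \is a @GRing.unit D ->
  tau_ qy d = Quaternion a b (qre d) (qix d) (- qjy d) (qkz d).
Proof. by move=> uy; apply: tau_E => //; apply: quatP => /=; ring. Qed.

(** The component of [d] in [K(x)]; the difference [d - xpart d] lies in
    [K(x) y], the orthogonal complement for the reduced norm. *)
Definition xpart d : D := Quaternion a b (qre d) (qix d) 0 0.

Lemma nrd_xpart d : nrd (xpart d) = qre d ^+ 2 - a * qix d ^+ 2.
Proof. by rewrite /nrd /=; ring. Qed.

Lemma nrd_xpartB d :
  nrd (d - xpart d) = - (b * (qjy d ^+ 2 - a * qkz d ^+ 2)).
Proof. by rewrite /nrd /=; ring. Qed.

Lemma nrd_xpart_orth d : nrd d = nrd (xpart d) + nrd (d - xpart d).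
Proof. by rewrite /nrd /=; ring. Qed.

Lemma pure_sqr v : tau v = - v -> v * v = - (nrd v)%:A.
Proof. by move=> tv; rewrite -mulq_tau tv mulrN opprK. Qed.

Lemma nrd_combination (s : K) v w :
  nrd (v + s *: w) = nrd v + s ^+ 2 * nrd w + s * (nrd v + nrd w - nrd (v - w)).
Proof. by rewrite /nrd /=; ring. Qed.

(** Since [v^2 = s^2 v0^2], the element [t0 = v + s v0] satisfies
    [v t0 = s t0 v0], so it conjugates [v] to [s v0], and so does [t0 v0].
    Hence [tau t * v * t] is [s nrd(t0 v0) v0] for [t = t0 v0].  The scalar is a
    square, removed by rescaling [t]: orthogonality of [v - v0] and [v0] gives
    [nrd t0 = 2 s (1 + s) nrd v0 = s (2 p)^2 nrd v0], so that
    [s nrd(t0 v0) = (2 s p nrd v0)^2]. *)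
Lemma pure_rank1 v v0 (s p : K) : 2 != 0 :> K ->
  tau v = - v -> tau v0 = - v0 ->
  nrd v = nrd v0 + nrd (v - v0) -> nrd v0 != 0 ->
  nrd v = s ^+ 2 * nrd v0 -> p ^+ 2 * 2 = 1 + s -> s != 0 -> p != 0 ->
  exists t : D, tau t * v * t = v0.
Proof.
move=> two0 tv tv0 orth N0 hs hp s0 p0.
pose t0 := v + s *: v0.
have tt0 : tau t0 = - t0 by rewrite tauD tauZ tv tv0 scalerN opprD.
have t0t0 : t0 * t0 = - (nrd v0 * s * (2 * p) ^+ 2)%:A.
  rewrite pure_sqr // nrd_combination hs; congr (- _ %:A).
  have -> : nrd (v - v0) = s ^+ 2 * nrd v0 - nrd v0.
    by rewrite -hs orth addrAC subrr add0r.
  have -> : (2 * p) ^+ 2 = 2 * (1 + s) by rewrite -hp; ring.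
  by ring.
have vt0 : v * t0 = s *: (t0 * v0).
  rewrite /t0 mulrDl mulrDr scalerDr -scalerAl -!scalerAr !pure_sqr // hs addrC.
  by rewrite -!scaleNr !scalerA; congr (_ + _ *: _); ring.
pose k := (2 * s * nrd v0 * p)^-1.
exists (k *: (t0 * v0)).
rewrite tauZ tauM tv0 tt0 mulrNN -!scalerAl -!scalerAr scalerA.
have -> : v0 * t0 * v * (t0 * v0) = v0 * (t0 * (v * t0)) * v0.
  by rewrite !mulrA.
rewrite vt0 -!scalerAr (mulrA t0) t0t0 -scaleNr mulr_algl -!scalerAr -!scalerAl.
rewrite pure_sqr // -scaleNr mulr_algl !scalerA -[RHS]scale1r.
by congr (_ *: _); rewrite /k; field; rewrite p0 N0 s0 two0.
Qed.

(** Reduces forms over [tau_ l] to forms over [tau]: if [tau l = eta l], left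
    multiplication by [l^-1] turns [eps]-symmetric elements for [tau_ l] into
    [eta eps]-symmetric elements for [tau]. *)
Lemma tau_twist l (eta eps : D) u : l \is a GRing.unit -> tau l = eta * l ->
  eta = 1 \/ eta = -1 -> eps = 1 \/ eps = -1 ->
  tau_ l u = eps * u -> tau (l^-1 * u) = eta * eps * (l^-1 * u).
Proof.
move=> ul tl heta heps hu; rewrite tauM tauV // tl.
have hx : tau u = l^-1 * (eps * u) * l.
  by rewrite -hu /tau_ mulrA mulKr // mulrVK.
by case: heta heps hx => -> [] -> ->;
  rewrite ?mulN1r ?mul1r ?invrN ?mulrN ?mulNr ?opprK ?mul1r ?mulrK.
Qed.

Lemma tau_fixed v : 2 != 0 :> K -> tau v = v -> v = (qre v)%:A.
Proof.
move=> two0; case: v => p q r s [] hq hr hs.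
have N x : - x = x :> K -> x = 0.
  move=> h; apply/eqP; have /eqP : 2 * x = 0.
    by rewrite mulr_natl mulr2n -{1}h addNr.
  by rewrite mulf_eq0 (negPf two0).
by apply: quatP => /=; rewrite ?(N _ hq) ?(N _ hr) ?(N _ hs) ?mulr1 ?mulr0.
Qed.

Lemma xpartZ (c : K) d : xpart (c *: d) = c *: xpart d.
Proof. by apply: quatP; rewrite /= ?mulr0. Qed.

Lemma xpartN d : xpart (- d) = - xpart d.
Proof. by apply: quatP; rewrite /= ?oppr0. Qed.

(** What the choices [l = 1, x, y] have in common: [tau_ l] is an involution
    respecting the decomposition of [D] into [K(x)] and [K(x) y], and [l] lies
    in one of the two summands. *)
Definition adapted l := [/\ l \is a GRing.unit,
  exists2 eta : D, eta = 1 \/ eta = -1 & tau l = eta * l,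
  forall d, tau_ l (xpart d) = xpart (tau_ l d) &
  xpart l = l \/ xpart l = 0].

Lemma adapted_sigma (sigma : D -> D) : division_algebra a b ->
  [\/ sigma = tau, sigma = tau_ qx | sigma = tau_ qy] ->
  exists2 l, adapted l & sigma =1 tau_ l.
Proof.
move=> hD; have ux : qx \is a @GRing.unit D.
  by apply: hD; apply/eqP => -[] /eqP; rewrite oner_eq0.
have uy : qy \is a @GRing.unit D.
  by apply: hD; apply/eqP => -[] /eqP; rewrite oner_eq0.
case=> ->.
- exists 1; last by move=> d; rewrite tau_1.
  split; [exact: unitr1| by exists 1; [left|rewrite tau1 mulr1] | | by left].
  by move=> d; rewrite !tau_1; apply: quatP; rewrite /= ?oppr0.
- exists qx => //; split=> //; last by left.
    by exists (-1); [right | apply: quatP => /=; ring].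
  by move=> d; rewrite !tau_qxE //; apply: quatP.
- exists qy => //; split=> //; last by right; apply: quatP.
    by exists (-1); [right | apply: quatP => /=; ring].
  by move=> d; rewrite !tau_qyE //; apply: quatP; rewrite /= ?oppr0.
Qed.

(** The algebraic half of the argument.  According to [tau_twist], [l^-1 u] is
    either a scalar, and then [xpart u <> 0] forces [u] to lie in [K(x)], or a
    pure quaternion, to which [pure_rank1] applies. *)
Lemma adapted_rank1 l (eps : D) u (s p : K) : 2 != 0 :> K ->
  adapted l -> eps = 1 \/ eps = -1 -> tau_ l u = eps * u ->
  nrd (xpart u) != 0 -> nrd u = s ^+ 2 * nrd (xpart u) ->
  p ^+ 2 * 2 = 1 + s -> s != 0 -> p != 0 ->
  tau_ l (xpart u) = eps * xpart u /\
  exists t, xpart u = tau_ l t * u * t.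
Proof.
move=> two0 [ul [eta heta tl] xl xpl] heps hu N0 hs hp s0 p0.
have hu0 : tau_ l (xpart u) = eps * xpart u.
  by rewrite xl hu; case: heps => ->; rewrite ?mul1r // !mulN1r xpartN.
split=> //.
have tv := tau_twist ul tl heta heps hu.
have tv0 := tau_twist ul tl heta heps hu0.
have [fixed|pure] : eta * eps = 1 \/ eta * eps = -1.
  by case: heta heps => -> [] ->; rewrite ?mulrNN ?mulr1 ?mul1r;
    [left | right | right | left].
- move: tv; rewrite fixed mul1r => /(tau_fixed two0) hc.
  have uE : u = qre (l^-1 * u) *: l by rewrite -mulr_algr -hc mulVKr.
  have xuE : xpart u = u.
    move: N0; rewrite uE xpartZ; case: xpl => -> //.
    by rewrite scaler0 /nrd /= !expr0n /= !mulr0 !subr0 addr0 eqxx.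
  by exists 1; rewrite mulr1 xuE /tau_ tau1 mulr1 divrr // mul1r.
move: tv tv0; rewrite pure !mulN1r => tv tv0.
have NV : nrd l^-1 != 0 by rewrite -unit_nrd unitrV.
have [|||t ht] := pure_rank1 two0 tv tv0 _ _ _ hp s0 p0.
- by rewrite -mulrBr !nrdM -mulrDr -nrd_xpart_orth.
- by rewrite nrdM mulf_neq0.
- by rewrite !nrdM hs; ring.
exists t; rewrite -[LHS](mulVKr ul) -ht /tau_ !mulrA //.
Qed.

End Involutions.

(** * Values of reduced norms *)

Section Parity.
Variables (K : fieldType) (nu : normalizedValuation K) (a pi : K).
Hypotheses (hK : vcomplete nu) (two0 : 2 != 0 :> K) (nu2 : nu 2 = 0).
Hypotheses (nua : nu a = 0) (hpi : uniformizer nu pi).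
Hypothesis hD : division_algebra a pi.
Local Notation D := (quaternion a pi).
Implicit Types d u : D.

Lemma nrd_neq0 d : d != 0 -> nrd d != 0.
Proof. exact: hD. Qed.

(** If [a = c^2], then [c + x] is a nonzero element of norm [c^2 - a = 0]. *)
Lemma division_nonsquare c : c ^+ 2 != a.
Proof.
apply: contraTneq isT => ca.
have /nrd_neq0/eqP[] : Quaternion a pi c 1 0 0 != 0.
  by apply/eqP => -[] _ /eqP; rewrite oner_eq0.
by rewrite /nrd /= ca; ring.
Qed.

(** [nrd (xpart u)] has even value and [nrd (u - xpart u)], being [-pi] times a
    norm from [K(x)], has odd value.  The one of smaller value determines the
    value of [nrd u], which is even. *)
Lemma xpart_dominant u (k : int) : u != 0 -> nu (nrd u) = k *+ 2 ->
  xpart u != 0 /\ nrd (u - xpart u) / nrd (xpart u) \in vball nu 1.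
Proof.
move=> u0 evenu; have [pi0 nupi] := hpi.
have oddW : nrd (u - xpart u) != 0 ->
    exists j : int, nu (nrd (u - xpart u)) = j *+ 2 + 1.
  rewrite nrd_xpartB oppr_eq0 mulf_eq0 negb_or => /andP[_ N0].
  have [j hj] := norm_valuation_even hK two0 nu2 nua division_nonsquare N0.
  by exists j; rewrite valuationN ?mulf_neq0 // valuationM // nupi hj addrC.
have [x0|x0] := eqVneq (xpart u) 0.
  have [|j] := oddW; rewrite x0 subr0 ?nrd_neq0 // evenu; lia.
split=> //; have U0 := nrd_neq0 x0; apply: div_vball1 => // W0.
have [j hj] := oddW W0; rewrite ltNge; apply/negP => le_WU.
have [i hi] : exists i : int, nu (nrd (xpart u)) = i *+ 2.
  move: U0; rewrite nrd_xpart => U0.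
  have [i hi] := norm_valuation_even hK two0 nu2 nua division_nonsquare U0.
  by exists i.
have lt_WU : nu (nrd (u - xpart u)) < nu (nrd (xpart u)).
  by move: le_WU; rewrite hi hj; lia.
have := valuationD_lt W0 U0 lt_WU; rewrite addrC -nrd_xpart_orth evenu hj; lia.
Qed.

End Parity.

(** Here [w] is the vector sent to a basis vector.  For the quaternion algebra
    the reduced norm of [v i] is then [nrd u * (nrd w)^2], so the value of
    [nrd u] modulo 2 can be read off from [v i]. *)
Lemma isometric_represents (D : nzRingType) (sigma : D -> D) m
    (u : D) (v : 'I_m -> D) :
  sigma 0 = 0 -> sigma 1 = 1 ->
  isometric (rank1_form sigma u) (diag_form sigma v) ->
  exists i w, v i = sigma w * u * w.
Proof.
move=> sigma0 sigma1 [f [[g fK gK] _ _ fh]].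
case: m v f g fK gK fh => [|m] v f g fK gK fh.
  (* An isometry onto the zero module is impossible, as [D] is nontrivial. *)
  have : const_mx 1 = 0 :> 'cV[D]_1.
    by apply: (can_inj fK); apply/matrixP => -[].
  by move/matrixP/(_ 0 0)/eqP; rewrite !mxE oner_eq0.
exists 0, (g (delta_mx 0 0) 0 0).
have := fh (g (delta_mx 0 0)) (g (delta_mx 0 0)).
rewrite !gK /rank1_form /diag_form big_ord1 => <-.
rewrite (bigD1 0) //= !mxE eqxx sigma1 mul1r mulr1 big1 ?addr0 // => i i0.
by rewrite !mxE (negPf i0) sigma0 !mul0r.
Qed.

Theorem lemma4p3
  (K : fieldType) (nu : normalizedValuation K) (hK : vcomplete nu)
  (hchar : 2%N \notin [pchar (residue_field nu)])
  (pi : K) (hpi : uniformizer nu pi)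
  (a : K) (ha : valring_unit nu a)
  (hD : division_algebra a pi)
  (sigma : quaternion a pi -> quaternion a pi)
  (hsigma : [\/ sigma = tau, sigma = tau_ qx | sigma = tau_ qy])
  (eps : quaternion a pi) (heps : eps = 1 \/ eps = -1)
  (delta alpha beta gamma : K)
  (hdelta : delta \in valring nu) (halpha : alpha \in valring nu)
  (hbeta : beta \in valring nu) (hgamma : gamma \in valring nu)
  (hunr : unramified nu sigma eps
    (rank1_form sigma
       (delta%:A + alpha *: qx + beta *: qy + gamma *: qz))) :
  eps_hermitian sigma eps (rank1_form sigma (delta%:A + alpha *: qx)) /\
  isometric
    (rank1_form sigma (delta%:A + alpha *: qx + beta *: qy + gamma *: qz))
    (rank1_form sigma (delta%:A + alpha *: qx)).
Proof.
have [two0 nu2] := residue_char_neq2 hchar.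
have nua := valuation_unit ha.
have [l hl sE] := adapted_sigma hD hsigma.
have [ul [eta heta tl] _ _] := hl.
have sD : {morph sigma : c d / c + d} by move=> c d; rewrite !sE tau_D.
have sM c d : sigma (c * d) = sigma d * sigma c by rewrite !sE tau_M.
have sK : involutive sigma by move=> c; rewrite !sE; apply: tau_K tl heta c.
have hermP := rank1_hermitianP hD sD sM sK heps.
have isoP := rank1_isometricP hD sM sK.
set u := delta%:A + _ + _ + _ in hunr *.
have -> : delta%:A + alpha *: qx = xpart u.
  by apply: quatP => /=; ring.
have [/hermP[u0 su] [m [ui [_ uiunit iso]]]] := hunr.
have [k evenu] : exists k : int, nu (nrd u) = k *+ 2.
  have s0 : sigma 0 = 0 by apply: (addrI (sigma 0)); rewrite -sD !addr0.
  have s1 : sigma 1 = 1 by rewrite -[LHS]mulr1 -{2}[1]sK -sM mulr1 sK.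
  have [i [w hw]] := isometric_represents s0 s1 iso.
  have [ui0] := uiunit i; rewrite /nuD hw !nrdM sE nrd_tau_ // => /eqP.
  have w0 : w != 0 by apply: contraNneq ui0 => w0; rewrite hw w0 mulr0.
  have Nw := nrd_neq0 hD w0; have Nu := nrd_neq0 hD u0.
  rewrite mulf_eq0 invr_eq0 /= orbF intr_eq0.
  rewrite !valuationM ?mulf_neq0 // => /eqP h.
  by exists (- nu (nrd w)); lia.
have [x0 dom] := xpart_dominant hK two0 nu2 nua hpi hD u0 evenu.
have N0 := nrd_neq0 hD x0.
have [s s2 s1] := sqrt_one_unit hK two0 nu2 dom.
have [p p2 p1] := sqrt_one_unit hK two0 nu2 (half_vball two0 nu2 s1).
have hs : nrd u = s ^+ 2 * nrd (xpart u).
  by rewrite s2 mulrDl mul1r divfK // -nrd_xpart_orth.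
have hp : p ^+ 2 * 2 = 1 + s by rewrite p2; field.
have su' : tau_ l u = eps * u by rewrite -sE.
have [hx [t ht]] := adapted_rank1 two0 hl heps su' N0 hs hp
  (one_unit_neq0 s1) (one_unit_neq0 p1).
split; first by apply/hermP; rewrite sE.
apply/isoP; exists t; last by rewrite sE.
by apply: contraNneq x0 => t0; rewrite ht t0 mulr0.
Qed.
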